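(* Let $N\ge 3$, $d\ge 2$, $1\le m\le N-2$, $n=N-m$, and $2\le K\le n$. Let $|\Phi_N\rangle\in(\mathbb{C}^d)^{\otimes N}$ be an arbitrary unit vector and let $\mathbf{r}\subset\{1,\dots,N\}$ be any set of $m$ measured parties. If $g$ is a real number such that $G_K\le g$ (i.e. $G_K(|\psi\rangle)\le g$ for every unit vector $|\psi\rangle\in(\mathbb{C}^d)^{\otimes n}$), then $$0\le E_L^{n,\mathbf{r}}(|\Phi_N\rangle)\le g .$$
   Context: All states are pure states (unit vectors) of systems whose parties each have Hilbert space $\mathbb{C}^d$. A unit vector in $(\mathbb{C}^d)^{\otimes n}$ is called $K$-separable if there is a partition of the $n$ parties into $K$ nonempty blocks such that the vector is a tensor product of $K$ vectors, one for each block. The $K$-separability based geometric measure (K-GM) of a unit vector $|\psi\rangle\in(\mathbb{C}^d)^{\otimes n}$, $2\le K\le n$, is $$G_K(|\psi\rangle)=1-\max_{|\phi\rangle\in\mathcal{S}_K}|\langle\phi|\psi\rangle|^2,$$ where $\mathcal{S}_K$ is the set of all $K$-separable unit vectors in $(\mathbb{C}^d)^{\otimes n}$. Localizable multipartite entanglement (LME): let $\mathbf{r}$ be a set of $m$ parties and $n=N-m\ge 2$. A complete set of local projectors on $\mathbf{r}$ is given by a choice, for each $j\in\mathbf{r}$, of an orthonormal basis of the space of party $j$; the $d^m$ outcomes $l$ are indexed by the product basis vectors $|\xi^l\rangle$ of $\bigotimes_{j\in\mathbf{r}}\mathbb{C}^d$ and $P^l=|\xi^l\rangle\langle\xi^l|\otimes\mathbb{I}$,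 with $\mathbb{I}$ the identity on the remaining $n$ parties. The outcome $l$ has probability $p^l=\langle\Phi_N|P^l|\Phi_N\rangle$, and when $p^l>0$ the post-measurement state is $P^l|\Phi_N\rangle/\sqrt{p^l}=|\xi^l\rangle\otimes|\psi_n^l\rangle$, where $|\psi^l_n\rangle$ is the resulting unit vector of the $n$ unmeasured parties. Then $$E_L^{n,\mathbf{r}}(|\Phi_N\rangle)=\sup_{\{P^l\}}\sum_{l=1}^{d^m}p^l\,G_K(|\psi_n^l\rangle),$$ the supremum being over all complete sets of local projectors on $\mathbf{r}$ (outcomes with $p^l=0$ contribute $0$). *)

(* Defs.v *)
From mathcomp Require Import all_boot all_order all_algebra.
From mathcomp Require Import complex.
From mathcomp Require Import classical_sets reals.

Set Implicit Arguments.
Unset Strict Implicit.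
Unset Printing Implicit Defensive.

Import Order.TTheory GRing.Theory Num.Theory.
Local Open Scope ring_scope.
Local Open Scope complex_scope.

Section FiniteDimensionalHilbertSpace.
Variables (R : realType) (I : finType).

(* The Hilbert space C^I, with its computational basis indexed by I. *)
Definition vect := {ffun I -> R[i]}.

(* Antilinear in the first argument. *)
Definition braket (phi psi : vect) : R[i] := \sum_(x : I) (phi x)^* * psi x.

Definition unit_vector (psi : vect) : Prop := braket psi psi = 1.

End FiniteDimensionalHilbertSpace.

(* #|I| orthonormal vectors of C^I always span, so that orthonormality alone
   makes the family e a basis. *)
Definition orthonormal_basis (R : realType) (I : finType)
    (e : I -> vect R I) : Prop :=
  forall k l : I, braket (e k) (e l) = (k == l)%:R.

(* P is the set of parties; a product basis vector is x : {ffun P -> 'I_d}. *)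
Definition state (R : realType) (P : finType) (d : nat) : Type :=
  vect R {ffun P -> 'I_d}.

Definition party_in (P : finType) (A : {set P}) : finType := {j : P | j \in A}.

Definition restrict (P : finType) (d : nat) (A : {set P})
    (x : {ffun P -> 'I_d}) : {ffun party_in A -> 'I_d} :=
  [ffun j => x (val j)].

Section GeometricMeasure.
Variables (R : realType) (P : finType) (d : nat).

(* finset.partition requires the blocks to be nonempty. *)
Definition K_separable (K : nat) (phi : state R P d) : Prop :=
  exists B : {set {set P}},
    [/\ finset.partition B [set: P], #|B| = K
      & exists f : forall A : {set P}, state R (party_in A) d,
          forall x, phi x = \prod_(A in B) f A (restrict A x)].

Definition separable_states (K : nat) : set (state R P d) :=
  [set phi | unit_vector phi /\ K_separable K phi]%classic.

(* For a unit vector psi, d > 0 and 1 <= K <= #|P|, the set of overlaps is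
   nonempty, bounded by 1, and the image of a compact set under a continuous
   map, so that sup is the maximum. *)
Definition GM (K : nat) (psi : state R P d) : R :=
  1 - sup [set Normc.normc (braket phi psi) ^+ 2
            | phi in separable_states K]%classic.

End GeometricMeasure.

Section LocalizableEntanglement.
Variables (R : realType) (P : finType) (d : nat) (r : {set P}).

(* e j k is the k-th vector of the basis chosen for the space of party j. *)
Definition local_bases : Type := party_in r -> 'I_d -> vect R 'I_d.

Definition outcome : finType := {ffun party_in r -> 'I_d}.

Definition outcome_vector (e : local_bases) (l : outcome) :
    state R (party_in r) d :=
  [ffun y : {ffun party_in r -> 'I_d} => \prod_j e j (l j) (y j)].

(* The operator |xi><xi| (x) I, given by its matrix entries. *)
Definition projector (xi : state R (party_in r) d) (Phi : state R P d) :
    state R P d :=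
  [ffun x => \sum_y xi (restrict r x) * (xi (restrict r y))^*
                    * (restrict (~: r) x == restrict (~: r) y)%:R * Phi y].

(* The partial inner product (<xi| (x) I) Phi. *)
Definition contract (xi : state R (party_in r) d) (Phi : state R P d) :
    state R (party_in (~: r)) d :=
  [ffun z => \sum_y (xi (restrict r y))^* * (z == restrict (~: r) y)%:R
                    * Phi y].

(* <Phi| P^l |Phi> is real because the projector is self-adjoint. *)
Definition outcome_prob (Phi : state R P d) (e : local_bases) (l : outcome) :
    R :=
  complex.Re (braket Phi (projector (outcome_vector e l) Phi)).

(* The factor |psi> in P^l |Phi> / sqrt p^l = |xi^l> (x) |psi>. *)
Definition post_state (Phi : state R P d) (e : local_bases) (l : outcome) :
    state R (party_in (~: r)) d :=
  [ffun z => contract (outcome_vector e l) Phi z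
             / (Num.sqrt (outcome_prob Phi e l))%:C].

Lemma post_stateE (Phi : state R P d) (e : local_bases) (l : outcome) x :
  projector (outcome_vector e l) Phi x
    / (Num.sqrt (outcome_prob Phi e l))%:C =
  outcome_vector e l (restrict r x) * post_state Phi e l (restrict (~: r) x).
Proof.
rewrite [post_state _ _ _ _]ffunE mulrA; congr (_ / _).
rewrite [projector _ _ _]ffunE [contract _ _ _]ffunE mulr_sumr.
by apply: eq_bigr => y _; rewrite !mulrA.
Qed.

Definition average_GM (K : nat) (Phi : state R P d) (e : local_bases) : R :=
  \sum_(l : outcome | 0 < outcome_prob Phi e l)
     outcome_prob Phi e l * GM K (post_state Phi e l).

(* The averages form a nonempty subset of [0, 1] for a unit vector Phi, d > 0
   and 1 <= K <= #|~: r|, so that sup is a genuine least upper bound. *)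
Definition LME (K : nat) (Phi : state R P d) : R :=
  sup [set average_GM K Phi e
        | e in [set e : local_bases | forall j, orthonormal_basis (e j)]]%classic.

End LocalizableEntanglement.

(* Main.v *)
(* Cauchy-Schwarz gives G_K >= 0.  Completeness of the local bases makes the
   outcome vectors a resolution of the identity on the measured parties, so the
   outcome probabilities sum to 1 and each average of G_K over the outcomes
   lies in [0, g]; the supremum over all measurements then does too.  The
   unmeasured parties form a subset of the parties and not {1, .., n}, hence G_K
   must be shown invariant under relabelling of the parties. *)
Require Import Defs.
From mathcomp Require Import all_boot all_order all_algebra.
From mathcomp Require Import complex reals.
From mathcomp Require Import classical_sets.
From mathcomp Require Import ring.

Import Order.TTheory GRing.Theory Num.Theory.
Local Open Scope ring_scope.

Set Implicit Arguments.
Unset Strict Implicit.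

(** * Cauchy-Schwarz and completeness of orthonormal bases *)

Section Braket.
Variables (R : realType) (I : finType).
Implicit Types phi psi : vect R I.

Lemma braketC phi psi : braket psi phi = (braket phi psi)^*.
Proof.
rewrite /braket rmorph_sum; apply: eq_bigr => x _.
by rewrite rmorphM /= conjCK mulrC.
Qed.

Lemma braket_subZ (c : complex R) phi psi :
  let v : vect R I := [ffun x => psi x - c * phi x] in
  braket v v = braket psi psi - c * (braket phi psi)^* - c^* * braket phi psi
               + c * c^* * braket phi phi.
Proof.
rewrite -braketC /braket !mulr_sumr -!sumrB -big_split /=.
apply: eq_bigr => x _; rewrite !ffunE rmorphB rmorphM /=.
ring.
Qed.

Lemma braket_ge0 phi : 0 <= braket phi phi.
Proof. by apply: sumr_ge0 => x _; rewrite mulrC mul_conjC_ge0. Qed.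

Lemma normc_braket_le1 phi psi :
  unit_vector phi -> unit_vector psi -> Normc.normc (braket phi psi) ^+ 2 <= 1.
Proof.
move=> phi1 psi1; rewrite -lecR rmorphXn /=.
change (`|braket phi psi| ^+ 2 <= 1); rewrite normCK.
(* Cauchy-Schwarz: the component of psi orthogonal to phi has norm >= 0. *)
have := braket_ge0 [ffun x => psi x - braket phi psi * phi x].
rewrite braket_subZ phi1 psi1 mulr1 (mulrC _^*) subrK.
by rewrite subr_ge0.
Qed.

(** Orthonormality reads [A *m B = 1] for the square matrices below. A one-sided inverse of a square
    matrix is two-sided, and the entries of [B *m A = 1] are the completeness relation. *)
Lemma orthonormal_basis_complete (e : I -> vect R I) (x y : I) :
  orthonormal_basis e -> \sum_k e k x * (e k y)^* = (x == y)%:R.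
Proof.
move=> ortho_e.
pose A : 'M[complex R]_#|I| := \matrix_(k, i) (e (enum_val k) (enum_val i))^*.
pose B : 'M[complex R]_#|I| := \matrix_(i, k) e (enum_val k) (enum_val i).
have AB1 : A *m B = 1%:M.
  apply/matrixP => k l; rewrite !mxE -(inj_eq enum_val_inj) -ortho_e /braket.
  rewrite [RHS](reindex_onto enum_val enum_rank) => [|z _]; last exact: enum_rankK.
  by apply: eq_big => [i|i _]; rewrite ?mxE ?enum_valK ?eqxx.
have /matrixP/(_ (enum_rank x) (enum_rank y)) := mulmx1C AB1.
rewrite !mxE (inj_eq enum_rank_inj) => <-.
rewrite [LHS](reindex_onto enum_val enum_rank) => [|z _]; last exact: enum_rankK.
by apply: eq_big => [i|i _]; rewrite ?mxE ?enum_rankK ?enum_valK ?eqxx.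
Qed.

Lemma orthonormal_delta :
  orthonormal_basis (fun k : I => [ffun x => (x == k)%:R] : vect R I).
Proof.
move=> k l; rewrite /braket (bigD1 k) //= !ffunE eqxx rmorph1 mul1r.
by rewrite big1 ?addr0 // => x /negPf xk; rewrite !ffunE xk rmorph0 mul0r.
Qed.

End Braket.

Section Overlap.
Variables (R : realType) (P : finType) (d K : nat).

Definition overlaps (psi : state R P d) : set R :=
  [set Normc.normc (braket phi psi) ^+ 2 | phi in separable_states K]%classic.

Lemma GM_ge0 (psi : state R P d) : unit_vector psi -> 0 <= GM K psi.
Proof.
move=> psi1; rewrite subr_ge0 -/(overlaps psi).
(* sup is 0 on the empty set (no K-separable state, e.g. K > #|P|). *)
have [->|/set0P ne] := eqVneq (overlaps psi) set0; first by rewrite sup0 ler01.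
apply: ge_sup ne _ => _ [phi [phi1 _] <-]; exact: normc_braket_le1.
Qed.

End Overlap.

(** * Invariance of the geometric measure under relabelling of the parties *)

Section Relabelling.
Variables (R : realType) (d K : nat).

Definition relabel (P Q : finType) (h : P -> Q) (psi : state R P d) :
    state R Q d :=
  [ffun y : {ffun Q -> 'I_d} => psi [ffun p => y (h p)]].

Variables (P Q : finType) (h : P -> Q) (h' : Q -> P).
Hypotheses (hK : cancel h h') (h'K : cancel h' h).

Lemma braket_relabel (phi psi : state R P d) :
  braket (relabel h phi) (relabel h psi) = braket phi psi.
Proof.
rewrite /braket.
pose F (y : {ffun Q -> 'I_d}) : {ffun P -> 'I_d} := [ffun p => y (h p)].
rewrite [RHS](reindex F) /=; first by apply: eq_bigr => y _; rewrite !ffunE.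
exists (fun x : {ffun P -> 'I_d} => [ffun q => x (h' q)]) => y _.
  by apply/ffunP => q; rewrite !ffunE h'K.
by apply/ffunP => p; rewrite !ffunE hK.
Qed.

Lemma relabelK (psi : state R P d) : relabel h' (relabel h psi) = psi.
Proof.
apply/ffunP => x; rewrite !ffunE; congr (psi _).
by apply/ffunP => p; rewrite !ffunE hK.
Qed.

Lemma K_separable_relabel (phi : state R P d) :
  K_separable K phi -> K_separable K (relabel h phi).
Proof.
have h_inj := can_inj hK.
move=> [B [partB cardB [f phiE]]].
exists [set [set h p | p in A] | A : {set P} in B]; split.
- have -> : [set: Q] = [set h p | p in [set: P]].
    by apply/setP => q; rewrite !inE -(h'K q) imset_f.
  by rewrite imset_partition.
- by rewrite card_imset //; apply: imset_inj.
(* The factors for Q are indexed by arbitrary A : {set Q} and defined through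
   h @^-1: A, which avoids transporting f along h @^-1: (h @: A) = A. *)
have mem_h (A : {set Q}) p : p \in h @^-1: A -> h p \in A by rewrite inE.
pose up (A : {set Q}) (y : {ffun party_in A -> 'I_d}) :
    {ffun party_in (h @^-1: A) -> 'I_d} :=
  [ffun j : party_in (h @^-1: A) =>
     y (exist _ (h (val j)) (mem_h A (val j) (valP j)))].
exists (fun A : {set Q} => [ffun y => f (h @^-1: A) (up A y)]) => y.
rewrite ffunE phiE big_imset /=; last by move=> A A' _ _; apply: imset_inj.
apply: eq_bigr => A _; rewrite !ffunE.
have -> : up (h @: A) (Defs.restrict (h @: A) y) =
          Defs.restrict (h @^-1: (h @: A)) [ffun p => y (h p)].
  by apply/ffunP => j; rewrite !ffunE.
(* Replacing every [A] on the left at once keeps the dependent application of [f] well typed. *)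
rewrite -[in LHS](_ : h @^-1: (h @: A) = A) //.
by apply/setP => p; rewrite !inE mem_imset.
Qed.

Lemma overlaps_relabel (psi : state R P d) :
  (overlaps K psi `<=` overlaps K (relabel h psi))%classic.
Proof.
move=> _ [phi [phi1 sep_phi] <-]; exists (relabel h phi); last first.
  by rewrite braket_relabel.
by split; [rewrite /unit_vector braket_relabel | apply: K_separable_relabel].
Qed.

End Relabelling.

Lemma GM_relabel (R : realType) (d K : nat) (P Q : finType)
    (h : P -> Q) (h' : Q -> P) (hK : cancel h h') (h'K : cancel h' h)
    (psi : state R P d) :
  GM K (relabel h psi) = GM K psi.
Proof.
congr (1 - sup _); apply/seteqP; split; last exact: (overlaps_relabel hK h'K).
(* The reverse inclusion is the same lemma for [h'], applied to the relabelled state. *)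
by rewrite -[X in (_ `<=` overlaps K X)%classic](relabelK hK);
  apply: (overlaps_relabel h'K hK).
Qed.

Lemma GM_le_card (R : realType) (d K n : nat) (P : finType) (g : R) :
  #|P| = n ->
  (forall psi : state R 'I_n d, unit_vector psi -> GM K psi <= g) ->
  forall psi : state R P d, unit_vector psi -> GM K psi <= g.
Proof.
move=> <- le_g psi psi1.
rewrite -(GM_relabel K (@enum_rankK P) (@enum_valK P)); apply: le_g.
by rewrite /unit_vector (braket_relabel (@enum_rankK P) (@enum_valK P)).
Qed.

(** * Outcome probabilities and post-measurement states *)

Section Measurement.
Variables (R : realType) (P : finType) (d : nat) (r : {set P}).
Variable Phi : state R P d.

Lemma restrict_inj (x y : {ffun P -> 'I_d}) :
  Defs.restrict r x = Defs.restrict r y ->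
  Defs.restrict (~: r) x = Defs.restrict (~: r) y -> x = y.
Proof.
move=> /ffunP xy_r /ffunP xy_rC; apply/ffunP => p.
have [p_r|p_r] := boolP (p \in r).
  by have := xy_r (exist _ p p_r); rewrite !ffunE.
have p_rC : p \in ~: r by rewrite inE.
by have := xy_rC (exist _ p p_rC); rewrite !ffunE.
Qed.

(** With V the contraction by xi, the projector is V^* V. Outcome probabilities are thus squared
    norms, hence real and nonnegative. *)
Lemma braket_contract (xi : state R (party_in r) d) :
  braket (contract xi Phi) (contract xi Phi) = braket Phi (projector xi Phi).
Proof.
rewrite /braket.
under eq_bigr => z _ do rewrite !ffunE rmorph_sum mulr_suml.
rewrite exchange_big; apply: eq_bigr => x _ /=.
under eq_bigr => z _ do rewrite mulr_sumr.
rewrite exchange_big ffunE mulr_sumr; apply: eq_bigr => y _ /=.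
(* Only the [z] that agrees with [x] on the unmeasured parties survives. *)
rewrite (bigD1 (Defs.restrict (~: r) x)) //= big1 ?addr0 => [|z /negPf zx];
  last first.
  by rewrite zx mulr0 mul0r rmorph0 mul0r.
rewrite eqxx mulr1 rmorphM /= conjCK.
by rewrite !mulrA; congr (_ * _ * _ * _); rewrite mulrC.
Qed.

Variable e : local_bases R d r.

Lemma outcome_probE (l : outcome d r) :
  (outcome_prob Phi e l)%:C%C =
  braket Phi (projector (outcome_vector e l) Phi).
Proof. by rewrite RRe_real // ger0_real // -braket_contract braket_ge0. Qed.

Lemma unit_post_state (l : outcome d r) :
  0 < outcome_prob Phi e l -> unit_vector (post_state Phi e l).
Proof.
move=> p_gt0; rewrite /unit_vector.
set s := (Num.sqrt (outcome_prob Phi e l))%:C%C.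
have s2 : s * s^* = (outcome_prob Phi e l)%:C%C.
  rewrite conj_Creal; last by rewrite ger0_real // lecR sqrtr_ge0.
  by rewrite -rmorphM -expr2 sqr_sqrtr // ltW.
have -> : braket (post_state Phi e l) (post_state Phi e l) =
    braket (contract (outcome_vector e l) Phi)
           (contract (outcome_vector e l) Phi) / (s * s^*).
  rewrite /braket mulr_suml; apply: eq_bigr => z _.
  by rewrite !(ffunE _ z) rmorphM fmorphV /= invfM (mulrC s^-1) mulrACA.
rewrite braket_contract -outcome_probE s2 divff //.
by rewrite fmorph_eq0 gt_eqF.
Qed.

Hypothesis ortho_e : forall j, orthonormal_basis (e j).

Lemma outcome_vector_complete (x y : {ffun party_in r -> 'I_d}) :
  \sum_l outcome_vector e l x * (outcome_vector e l y)^* = (x == y)%:R.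
Proof.
under eq_bigr => l _ do rewrite !ffunE rmorph_prod -big_split /=.
(* The sum over outcomes of products over parties factors into one completeness sum per party. *)
rewrite -(bigA_distr_bigA (fun j k => e j k (x j) * (e j k (y j))^*)).
under eq_bigr => j _ do rewrite orthonormal_basis_complete //.
have [->|neq_xy] := eqVneq x y; first by rewrite big1 // => j _; rewrite eqxx.
have [j /negPf xy_j] : exists j, x j != y j.
  by apply/existsP; rewrite -negb_forall; apply: contra neq_xy => /eqfunP/ffunP->.
by rewrite (bigD1 j) //= xy_j mul0r.
Qed.

Lemma sum_outcome_prob :
  unit_vector Phi -> \sum_l outcome_prob Phi e l = 1.
Proof.
move=> Phi1; apply: (@complexI R); rewrite rmorph_sum rmorph1 -Phi1 /=.
under eq_bigr => l _ do rewrite outcome_probE.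
rewrite /braket exchange_big; apply: eq_bigr => x _ /=.
rewrite -mulr_sumr; congr (_ * _).
under eq_bigr => l _ do rewrite ffunE.
rewrite exchange_big /= (bigD1 x) //= [X in _ + X]big1 ?addr0 => [|y neq_yx];
  rewrite -mulr_suml -mulr_suml outcome_vector_complete.
  by rewrite !eqxx !mul1r.
(* Off the diagonal one of the two deltas vanishes: [x] and [y] cannot agree on both [r] and its
   complement. *)
have [xy_r|] := eqVneq; last by rewrite !mul0r.
have [xy_rC|] := eqVneq; last by rewrite mulr0 mul0r.
by rewrite (restrict_inj xy_r xy_rC) eqxx in neq_yx.
Qed.

Lemma outcome_prob_ge0 (l : outcome d r) : 0 <= outcome_prob Phi e l.
Proof. by rewrite -lecR outcome_probE -braket_contract braket_ge0. Qed.

Lemma average_GM_ge0 (K : nat) : 0 <= average_GM K Phi e.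
Proof.
apply: sumr_ge0 => l p_gt0; apply: mulr_ge0; first exact: ltW.
exact/GM_ge0/unit_post_state.
Qed.

Lemma average_GM_le (K : nat) (g : R) : unit_vector Phi ->
  (forall psi : state R (party_in (~: r)) d, unit_vector psi -> GM K psi <= g) ->
  average_GM K Phi e <= g.
Proof.
move=> Phi1 le_g.
(* Writing [g] as the average of the constant [g] allows a termwise comparison; outcomes of
   probability 0 add nothing. *)
rewrite -[leRHS]mul1r -(sum_outcome_prob Phi1) mulr_suml.
rewrite [leRHS](bigID (fun l => 0 < outcome_prob Phi e l)) /=.
rewrite [X in _ <= _ + X]big1 ?addr0 => [|l]; last first.
  by rewrite lt_def outcome_prob_ge0 andbT negbK => /eqP->; rewrite mul0r.
apply: ler_sum => l p_gt0; rewrite ler_pM2l //.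
exact/le_g/unit_post_state.
Qed.

End Measurement.

Theorem theorem1 (R : realType) (N d m n K : nat)
  (hN : (3 <= N)%N) (hd : (2 <= d)%N)
  (hm : (1 <= m <= N - 2)%N) (hn : n = (N - m)%N) (hK : (2 <= K <= n)%N)
  (Phi : state R 'I_N d) (hPhi : unit_vector Phi)
  (r : {set 'I_N}) (hr : #|r| = m)
  (g : R) (hg : forall psi : state R 'I_n d, unit_vector psi -> GM K psi <= g) :
  0 <= LME r K Phi /\ LME r K Phi <= g.
Proof.
have card_rC : #|party_in (~: r)| = n.
  by rewrite card_sig cardsCs finset.setCK hr card_ord hn.
have {}hg := GM_le_card card_rC hg.
have avg_le (e : local_bases R d r) :
    (forall j, orthonormal_basis (e j)) -> average_GM K Phi e <= g.
  by move=> ortho_e; apply: average_GM_le.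
(* Measuring in the computational basis shows that the set of averages is nonempty, and its average
   bounds the supremum from below. *)
pose delta : local_bases R d r := fun _ k => [ffun x => (x == k)%:R].
have ortho_delta j : orthonormal_basis (delta j) by apply: orthonormal_delta.
split; last first.
  apply: ge_sup => [|_ [e ortho_e <-]]; last exact: avg_le.
  by exists (average_GM K Phi delta), delta.
apply: le_trans (average_GM_ge0 Phi delta K) _.
(* A [sup] dominates the members of its set only when the set is bounded above; here [g] is a
   bound. *)
apply: ub_le_sup; last by exists delta.
by exists g => _ [e ortho_e <-]; apply: avg_le.
Qed.
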